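(* Let $p$ be an odd prime, let $G$ be a noncyclic $2$-generator finite $p$-group of nilpotency class at most two, and let $\alpha$ and $\beta$ be the two largest type invariants of $G$ (counted with multiplicity). Then $G$ is capable if and only if $\alpha=\beta$.
   Context: A group $G$ is capable if there exists a group $H$ with $G\cong H/Z(H)$, where $Z(H)$ is the center of $H$. A finite $p$-group of class at most two with $p$ odd is regular in the sense of P. Hall, so $\Omega_i(G)=\{g\in G : g^{p^i}=e\}$ is a subgroup for every $i\ge 0$. Write $|\Omega_i(G):\Omega_{i-1}(G)|=p^{\omega_i}$ for $i\geq 1$. The type invariants of $G$ (P. Hall) are the integers $\mu_1\geq\mu_2\geq\cdots\geq\mu_{\omega_1}\geq 1$, where $\mu_s$ is the number of indices $i\geq 1$ with $\omega_i\geq s$, for $1\le s\le\omega_1$. (For a finite abelian $p$-group these are the exponents of the orders of the cyclic factors in a decomposition into cyclic groups.) *)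

(* Defs.v *)
Set Warnings "-notation-overridden".
From HB Require Import structures.
From mathcomp Require Import all_boot all_fingroup all_solvable.
From mathcomp Require Import generic_quotient boolp.

Set Implicit Arguments.
Unset Strict Implicit.
Unset Printing Implicit Defensive.
Set Warnings "-redundant-canonical-projection".

Local Open Scope group_scope.
Local Open Scope quotient_scope.

(* The quotient H / Z(H) of a possibly infinite group H; MathComp's own        *)
(* quotient G / H is restricted to finite groups.                              *)
Section CentralQuotient.
Variable H : groupType.
Implicit Types x y z : H.

Definition central z : Prop := forall x, commute z x.

Lemma central1 : central 1.
Proof. by move=> x; rewrite /commute mul1g mulg1. Qed.

Lemma centralV x : central x -> central x^-1.
Proof.
by move=> cx y; apply: (mulgI x); rewrite mulVKg mulgA cx mulgK.
Qed.

Lemma centralM x y : central x -> central y -> central (x * y).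
Proof. by move=> cx cy z; rewrite /commute -mulgA (cy z) mulgA (cx z) mulgA. Qed.

(* x and y lie in the same (left) coset of Z(H).                               *)
Definition center_eq x y : bool := `[< central (x^-1 * y) >].

Lemma center_eqP x y :
  reflect (exists2 z, central z & y = x * z) (center_eq x y).
Proof.
apply: (iffP (asboolP _)) => [cxy | [z cz ->]]; last by rewrite mulKg.
by exists (x^-1 * y) => //; rewrite mulVKg.
Qed.

Lemma center_eq_refl : reflexive center_eq.
Proof.
by move=> x; apply/center_eqP; exists 1; [exact: central1 | rewrite mulg1].
Qed.

Lemma center_eq_imp x y : center_eq x y -> center_eq y x.
Proof.
move/center_eqP=> [z cz ->]; apply/center_eqP.
by exists z^-1; [exact: centralV | rewrite mulgK].
Qed.

Lemma center_eq_sym : symmetric center_eq.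
Proof. by move=> x y; apply/idP/idP; apply: center_eq_imp. Qed.

Lemma center_eq_trans : transitive center_eq.
Proof.
move=> y x w /center_eqP[z cz ->] /center_eqP[t ct ->]; apply/center_eqP.
by exists (z * t); [exact: centralM | rewrite mulgA].
Qed.

Canonical center_equiv :=
  EquivRel center_eq center_eq_refl center_eq_sym center_eq_trans.

Definition central_quotient := {eq_quot center_equiv}.

HB.instance Definition _ := Choice.on central_quotient.
HB.instance Definition _ := EqQuotient.on central_quotient.

Definition cq_one : central_quotient := \pi_central_quotient 1.
Definition cq_mul (a b : central_quotient) : central_quotient :=
  \pi_central_quotient (repr a * repr b).
Definition cq_inv (a : central_quotient) : central_quotient :=
  \pi_central_quotient (repr a)^-1.

Lemma cq_eq x y : center_eq x y -> \pi_central_quotient x = \pi_central_quotient y.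
Proof. by move=> exy; apply/eqmodP. Qed.

Lemma cq_repr x : center_eq (repr (\pi_central_quotient x)) x.
Proof. by apply/eqmodP; rewrite reprK. Qed.

Lemma cq_mulE x y : cq_mul (\pi_central_quotient x) (\pi_central_quotient y) = \pi_central_quotient (x * y).
Proof.
apply: cq_eq.
have /center_eqP[z cz {2}->] := cq_repr x.
have /center_eqP[t ct {2}->] := cq_repr y.
apply/center_eqP; exists (z * t); first exact: centralM.
by rewrite -!mulgA; congr (_ * _); rewrite !mulgA cz.
Qed.

Lemma cq_invE x : cq_inv (\pi_central_quotient x) = \pi_central_quotient x^-1.
Proof.
apply: cq_eq; have /center_eqP[z cz {2}->] := cq_repr x.
apply/center_eqP; exists z^-1; first exact: centralV.
by rewrite invgM; apply: centralV.
Qed.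

Lemma cq_mulA : associative cq_mul.
Proof.
elim/quotW=> x; elim/quotW=> y; elim/quotW=> z.
by rewrite (cq_mulE y z) (cq_mulE x y) (cq_mulE x) (cq_mulE _ z) mulgA.
Qed.

Lemma cq_mul1 : left_id cq_one cq_mul.
Proof. by elim/quotW=> x; rewrite cq_mulE mul1g. Qed.

Lemma cq_mulr1 : right_id cq_one cq_mul.
Proof. by elim/quotW=> x; rewrite cq_mulE mulg1. Qed.

Lemma cq_mulV : left_inverse cq_one cq_inv cq_mul.
Proof. by elim/quotW=> x; rewrite cq_invE cq_mulE mulVg. Qed.

Lemma cq_mulrV : right_inverse cq_one cq_inv cq_mul.
Proof. by elim/quotW=> x; rewrite cq_invE cq_mulE mulgV. Qed.

HB.instance Definition _ := isGroup.Build central_quotient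
  cq_mulA cq_mul1 cq_mulr1 cq_mulV cq_mulrV.

Lemma cq_piM x y :
  \pi_central_quotient (x * y) = \pi_central_quotient x * \pi_central_quotient y :> central_quotient.
Proof. exact/esym/cq_mulE. Qed.

End CentralQuotient.

Section Capable.
Variable gT : finGroupType.

Definition capable (G : {group gT}) : Prop :=
  exists (H : groupType) (f : {multiplicative [subg G] -> central_quotient H}),
    bijective f.

Variables (p : nat) (G : {group gT}).

(* 'Ldiv_(p ^ i)(G) is {g in G | g ^+ (p ^ i) = 1}, a subgroup when G is       *)
(* regular; it is used rather than 'Ohm_i(G), the subgroup it generates.       *)
Definition omega (i : nat) : nat :=
  logn p #|'Ldiv_(p ^ i)%N(G) : 'Ldiv_(p ^ i.-1)%N(G)|.

(* For a p-group G, 'Ldiv_(p ^ i)(G) = G for i >= logn p #|G|, hence           *)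
(* omega i = 0 for i > logn p #|G|: the bound on i loses nothing when s >= 1.  *)
Definition type_invariant (s : nat) : nat :=
  count (fun i => s <= omega i) (iota 1 (logn p #|G|)).

(* Nonincreasing by construction, since type_invariant s decreases with s.     *)
Definition type_invariants : seq nat :=
  [seq type_invariant s | s <- iota 1 (omega 1)].

End Capable.

(* Main.v *)
Set Warnings "-notation-overridden -redundant-canonical-projection".
Require Import Defs.
From HB Require Import structures.
From mathcomp Require Import all_boot all_fingroup all_solvable.
From mathcomp Require Import zmodp generic_quotient boolp.

(* Let n = p^e be the exponent of G and m = n / p. The p^i-th power map induces *)
(* a bijection from the cosets of {x | x^(p^i) = 1} onto the p^i-th powers, so  *)
(* alpha = beta if and only if G has more than p distinct m-th powers.          *)
(*   If it has at most p of them, then G = <a, b> with b^m = 1 and a^m <> 1. If *)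
(* G = H / Z(H), then H has class at most 3, and lifts x, y of a, b satisfy     *)
(* [y, x]^m = 1 because y^m is central and m is odd; this forces [x^m, y] = 1,  *)
(* so x^m is central and a^m = 1, a contradiction.                              *)
(*   If it has more than p, then some a in G has order n modulo the cyclic      *)
(* group G', and G = B ><| <a> with B = <b, G'> abelian and b of order n. There *)
(* is an automorphism z of G that fixes B pointwise and maps a to a b. In       *)
(* H = G ><| <z> the maps a |-> a, z |-> b, x |-> [a, x] for x in B extend to a *)
(* morphism from H onto G whose kernel is exactly Z(H).                         *)

Set Implicit Arguments.
Unset Strict Implicit.
Unset Printing Implicit Defensive.

Local Open Scope group_scope.
Local Open Scope quotient_scope.

(** In the argument sketched above, [type_invariants01] and [expn_omega_exponent] turn alpha = beta
    into a count of m-th powers. Necessity: [gen2_expg_eq1] normalises the generators and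
    [capable_exp_gen] gives the contradiction. Sufficiency: [capable_of_powers] finds the splitting
    and [central_extension_onto] builds H. Odd n divides C(n, 2), which kills the correction
    [y, x]^C(n, 2) in the n-th power of a product; oddness also cancels a factor 2 in [d_eq1]. *)

(** * Capability as a surjection with kernel Z(H) *)

Lemma morph_group (H K : groupType) (f : H -> K) :
  {morph f : x y / x * y} -> exists F : UMagmaMorphism.type H K, F = f :> (H -> K).
Proof.
move=> fM; have f1 : f 1 = 1 by apply: (mulgI (f 1)); rewrite -fM !mulg1.
pose F : UMagmaMorphism.type H K :=
  HB.pack f (isUMagmaMorphism.Build _ _ f (f1, fM)).
by exists F.
Qed.

(** Avoids computing in H / Z(H). One way, compose the projection with the inverse isomorphism; the
    other way, lift G to H by a section of f, whose choice does not matter modulo Z(H). *)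
Lemma capableP (gT : finGroupType) (G : {group gT}) :
  capable G <-> exists (H : groupType) (f : UMagmaMorphism.type H [subg G]%type),
    (forall g, exists h, f h = g) /\ (forall h, f h = 1 <-> central h).
Proof.
split=> [[H [f [g fK gK]]]|[H [f [f_surj kerf]]]].
  have gM := can2_gmulfM fK gK.
  pose pih (h : H) : [subg G] := g (\pi_(central_quotient H) h).
  have pihM : {morph pih : x y / x * y} by move=> x y; rewrite /pih cq_piM gM.
  have [F defF] := morph_group pihM.
  have pih1 : pih 1 = 1 by rewrite -defF gmulf1.
  exists H, F; rewrite defF.
  split=> [x | h]; first by exists (repr (f x)); rewrite /pih reprK fK.
  rewrite -pih1 /pih; split=> [/(can_inj gK)/eqmodP | ch].
    by move=> /center_eq_imp/center_eqP[z cz ->]; rewrite mul1g.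
  congr g; apply/eqmodP/center_eq_imp/center_eqP.
  by exists h; rewrite ?mul1g.
have [s sK] := choice f_surj.
pose q x : central_quotient H := \pi_(central_quotient H) (s x).
have eq_pi h1 h2 : f h1 = f h2 ->
    \pi_(central_quotient H) h1 = \pi_(central_quotient H) h2.
  move=> eqf; apply/cq_eq/asboolP/kerf.
  by rewrite gmulfM gmulfV eqf mulVg.
have qM : {morph q : x y / x * y}.
  by move=> x y; rewrite /q -cq_piM; apply: eq_pi; rewrite gmulfM !sK.
have [F defF] := morph_group qM.
exists H, F; rewrite defF; exists (fun u => f (repr u)) => [x | u].
  rewrite /q; have /center_eqP[z /kerf cz eqz] := cq_repr (s x).
  by have := congr1 f eqz; rewrite gmulfM cz mulg1 sK => /esym.
by rewrite /q -[u in RHS]reprK; apply: eq_pi; rewrite sK.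
Qed.

(* The carrier is abstract so that no group structure inferred on it, such as   *)
(* the componentwise one on pairs, interferes with the given law.               *)
Section GroupOfLaw.
Variables (T : choiceType) (mul : T -> T -> T) (one : T) (inv : T -> T).

Definition law_carrier (mulA : associative mul) (mul1 : left_id one mul)
  (mulr1 : right_id one mul) (mulV : left_inverse one inv mul)
  (mulrV : right_inverse one inv mul) : Type := T.

Variables (mulA : associative mul) (mul1 : left_id one mul).
Variables (mulr1 : right_id one mul) (mulV : left_inverse one inv mul).
Variable mulrV : right_inverse one inv mul.
Local Notation LT := (law_carrier mulA mul1 mulr1 mulV mulrV).

HB.instance Definition _ := Choice.on LT.
HB.instance Definition _ := isGroup.Build LT mulA mul1 mulr1 mulV mulrV.

Definition group_of_law : groupType := LT.

End GroupOfLaw.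

(** * The extension of G by an automorphism, and its center *)

(* With G = B ><| <a>, r is the projection onto <a> and t maps a^i x to (a b)^i *)
(* for x in B. Then g^z = g * d g, and (k, g) below stands for z^k g.           *)
Section Extension.

Variables (X : finGroupType) (m : nat) (a b : X) (r t : UMagmaMorphism.type X X).
Local Notation n := m.+1.
Local Notation c := [~ b, a].

Hypothesis odd_n : odd n.
Hypothesis expX : forall x : X, x ^+ n = 1.
Hypothesis class2 : forall x y z : X, commute [~ x, y] z.
Hypothesis span : forall g, exists i k l, g = a ^+ i * b ^+ k * c ^+ l.
Hypothesis ord_b : forall i, b ^+ i = 1 -> n %| i.
Hypotheses (ra : r a = a) (rb : r b = 1) (ta : t a = a * b) (tb : t b = 1).

Let d g := (r g)^-1 * t g.

Let r_span i k l : r (a ^+ i * b ^+ k * c ^+ l) = a ^+ i.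
Proof.
by rewrite !gmulfM !gmulfXn gmulfR ra rb comm1g !expg1n !mulg1.
Qed.

Let t_span i k l : t (a ^+ i * b ^+ k * c ^+ l) = (a * b) ^+ i.
Proof.
by rewrite !gmulfM !gmulfXn gmulfR ta tb comm1g !expg1n !mulg1.
Qed.

Let dE i k l : d (a ^+ i * b ^+ k * c ^+ l) = b ^+ i * c ^+ 'C(i, 2).
Proof.
rewrite /d r_span t_span expMg_Rmul; last 2 first.
- exact/commute_sym/class2.
- exact/commute_sym/class2.
by rewrite -mulgA mulKg.
Qed.

Let cC z j : commute (c ^+ j) z.
Proof. exact/commute_sym/commuteX/commute_sym/class2. Qed.

Let ker_span x : r x = 1 -> exists k l, x = b ^+ k * c ^+ l.
Proof.
have [i [k [l ->]]] := span x; rewrite r_span => ->.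
by exists k, l; rewrite mul1g.
Qed.

Let ker_commute x y : r x = 1 -> r y = 1 -> commute x y.
Proof.
move=> /ker_span[i [j ->]] /ker_span[k [l ->]].
apply/commuteM; last exact/commute_sym/cC.
by apply/commute_sym/commuteM; [exact: commuteX2 | exact/commute_sym/cC].
Qed.

Let d_ker x : r x = 1 -> d x = 1.
Proof. by move=> /ker_span[k [l ->]]; have := dE 0 k l; rewrite !mul1g. Qed.

Let r_dX g k : r (d g ^+ k) = 1.
Proof.
have [i [k' [l ->]]] := span g; rewrite dE gmulfXn gmulfM !gmulfXn gmulfR ra rb.
by rewrite comm1g !(expg1n, mulg1).
Qed.

Let r_d g : r (d g) = 1. Proof. exact: (r_dX g 1). Qed.

(** This crossed homomorphism identity makes g |-> g * d g multiplicative. On d g, conjugation by h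
    agrees with conjugation by r h: they differ by an element of the kernel of r, which is abelian
    and contains d g. *)
Let dM g h : d (g * h) = d g ^ h * d h.
Proof.
have -> : d g ^ h = d g ^ r h.
  have [i [k [l ->]]] := span h; rewrite r_span -mulgA conjgM.
  apply/conjg_fixP/commgP/ker_commute; first by rewrite gmulfJ r_d conj1g.
  by have := r_span 0 k l; rewrite !mul1g.
by rewrite /d !gmulfM invgM conjgE !mulgA mulgK.
Qed.

Let d_mul_ker g x : r x = 1 -> d (g * x) = d g.
Proof.
move=> rx; rewrite dM (d_ker rx) mulg1; apply/conjg_fixP/commgP.
by apply: ker_commute.
Qed.

Let T : choiceType := ('I_n * X)%type.

(** The semidirect product law: g^(z^l) = g * d g ^+ l, since d is unchanged by factors in the
    kernel of r. Exponents of z may be taken modulo n because d g ^+ n = 1. *)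
Let mulT (u v : T) : T := (Zp_add u.1 v.1, u.2 * d u.2 ^+ v.1 * v.2).
Let oneT : T := (ord0, 1).
Let invT (u : T) : T := (Zp_opp u.1, (u.2 * d u.2 ^+ Zp_opp u.1)^-1).

Let expZ (x : X) (k l : 'I_n) : x ^+ Zp_add k l = x ^+ k * x ^+ l.
Proof. by rewrite expg_mod ?expX // expgD. Qed.

Let mulTA : associative mulT.
Proof.
move=> [k g] [l h] [q w]; congr pair; rewrite /= ?Zp_addA //.
have -> : d (g * d g ^+ l * h) = d g ^ h * d h.
  by rewrite dM (d_mul_ker _ (r_dX g l)).
rewrite [X in _ * X * _ = _]expZ (@expgMn _ (d g ^ h) (d h)); last first.
  by apply: ker_commute; rewrite ?gmulfJ r_d ?conj1g.
rewrite -conjXg !mulgA; congr (_ * _ * _).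
by rewrite -!mulgA -conjgC.
Qed.

Let mul1T : left_id oneT mulT.
Proof.
by case=> k g; congr pair; rewrite /= ?Zp_add0z // d_ker ?gmulf1 // expg1n !mul1g.
Qed.

Let mulT1 : right_id oneT mulT.
Proof. by case=> k g; congr pair; rewrite /= ?mulg1 // Zp_addC Zp_add0z. Qed.

Let mulTV : right_inverse oneT invT mulT.
Proof. by case=> k g; congr pair; rewrite /= ?mulgV // Zp_addC Zp_addNz. Qed.

Let mulVT : left_inverse oneT invT mulT.
Proof.
move=> u; rewrite -[LHS]mulT1 -(mulTV (invT u)) mulTA -(mulTA (invT u)).
by rewrite mulTV mulT1 mulTV.
Qed.

Let H : groupType := group_of_law mulTA mul1T mulT1 mulVT mulTV.

Let f (u : T) : X := b ^+ u.1 * [~ a, u.2] * r u.2.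

Let commC (x y z : X) : [~ x, y] * z = z * [~ x, y].
Proof. exact: class2. Qed.

Let adM (x g h : X) : [~ x, g * h] = [~ x, g] * [~ x, h].
Proof.
rewrite commgMJ commC; congr (_ * _).
exact/conjg_fixP/commgP/class2.
Qed.

Let adX (x g : X) k : [~ x, g ^+ k] = [~ x, g] ^+ k.
Proof. exact/commgX/commute_sym/class2. Qed.

Let adXl (x g : X) k : [~ x ^+ k, g] = [~ x, g] ^+ k.
Proof. exact/commXg/commute_sym/class2. Qed.

(** Needed for [fM]: the factor [~ a, d g] ^+ l coming from g^(z^l) has to match the commutator
    created by moving r g past b ^+ l. *)
Let comm_ad g : [~ a, d g] = [~ r g, b].
Proof.
have [i [k [l ->]]] := span g; rewrite r_span dE adM !adX adXl.
by rewrite (_ : [~ a, c] = 1) ?expg1n ?mulg1 //; apply/eqP/commgP/commute_sym/class2.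
Qed.

Let fM : {morph f : u v / mulT u v >-> u * v}.
Proof.
have swap (x y A B C u v : X) : (forall z, commute A z) ->
    (forall z, commute B z) -> (forall z, commute C z) ->
    u * y = y * u * B -> x * y * (A * B * C) * (u * v) = x * A * u * (y * C * v).
  move=> cA cB cC' uy; rewrite -!mulgA; congr (_ * _).
  rewrite (mulgA y) -(cA y) -!mulgA; congr (_ * _).
  rewrite (mulgA u y) uy -!mulgA; congr (_ * _).
  by rewrite (mulgA C) (cC' u) !(mulgA B) (cB u) -!mulgA.
move=> [k g] [l h].
change (b ^+ Zp_add k l * [~ a, g * d g ^+ l * h] * r (g * d g ^+ l * h) =
  b ^+ k * [~ a, g] * r g * (b ^+ l * [~ a, h] * r h)).
rewrite expZ !gmulfM r_dX mulg1 !adM.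
apply: swap => [z|z|z|]; try exact: class2.
by rewrite adX comm_ad -adX commgC.
Qed.

Let f_surj g : exists u, f u = g.
Proof.
have [i [k [l ->]]] := span g.
(* Here a ^+ i maps to itself, z^k to b ^+ k, and b^-l to [~ a, b]^-l = c ^+ l. *)
exists (mulT (ord0, a ^+ i) (inZp k, b^-1 ^+ l)).
rewrite fM /f /= commgXg !mul1g !gmulfXn gmulfV rb ra invg1 expg1n mulg1.
by rewrite (expg_mod _ (expX b)) adX commgV ?invg_comm ?mulgA.
Qed.

(** If b^i c^C(i, 2) = 1, commuting with a gives c^i = 1, and squaring gives b^(2i) = 1 because 2
    C(i, 2) = i (i - 1). As n is odd, n divides i. *)
Let d_eq1 g : d g = 1 -> r g = 1.
Proof.
have [i [k [l ->]]] := span g; rewrite dE r_span => bc1.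
have c1 : c ^+ i = 1.
  have := congr1 (fun x => [~ a, x]) bc1.
  rewrite /= adM !adX commg1 (_ : [~ a, c] = 1) ?expg1n ?mulg1 //.
    by move=> ab1; rewrite -invg_comm expgVn ab1 invg1.
  by apply/eqP/commgP/commute_sym/class2.
have /ord_b : b ^+ i.*2 = 1.
  have := congr1 (fun x => x ^+ 2) bc1; rewrite expg1n expgMn; last exact/commute_sym/cC.
  rewrite -!expgM muln2 (mulnC _ 2) mul_bin_left bin1 mulnC (expgM c) c1.
  by rewrite expg1n mulg1.
rewrite -muln2 Gauss_dvdl; last by rewrite coprimen2.
by case/dvdnP=> q ->; rewrite mulnC expgM expX expg1n.
Qed.

Let ker_f (u : H) : f u = 1 <-> central u.
Proof.
(* For central u, commuting with z yields d g = 1, hence r g = 1; commuting with a then yields f u =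
   1. *)
case: u => k g; rewrite /f /=; split=> [fu1 [l h] | cu]; last first.
  have := congr1 snd (cu (inZp 1, 1)); have := congr1 snd (cu (ord0, a)).
  rewrite /= mulg1 mul1g (d_ker gmulf1) expg1n mul1g => ga.
  rewrite (expg_mod 1 (expX (d g))) mulg1 -[X in _ = X]mulg1 => /mulgI/d_eq1 rg.
  rewrite rg mulg1; move: ga; rewrite /d ra ta mulKg => ga.
  apply: (mulIg g); apply: (mulgI a); rewrite mul1g [RHS]commgC ga.
  by rewrite -(mulgA (b ^+ k)) (commC a g g) !mulgA.
have rg : r g = 1.
  have r_ad : r [~ a, g] = [~ a, r g] by rewrite -{2}ra; exact: gmulfR.
  have := congr1 r fu1; rewrite 2!gmulfM gmulf1 gmulfXn rb r_ad expg1n mul1g.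
  have [i [x [y ->]]] := span g.
  by rewrite r_span gmulfXn ra commgXg mul1g.
have bk : b ^+ k = [~ g, a].
  by rewrite -invg_comm; apply: (mulIg [~ a, g]); rewrite mulVg -fu1 rg mulg1.
congr pair; rewrite /= ?(Zp_addC k) // d_ker // expg1n mulg1.
have [i [x [y defh]]] := span h.
(* With h in a^i B, d h ^+ k is b^(ik) c^(k C(i, 2)). Since b ^+ k = [~ g, a] is central, c^k =
   [~ b ^+ k, a] = 1, and b^(ik) = [~ g, a]^i = [~ g, h]. *)
have -> : d h ^+ k = [~ g, h].
  have cx : [~ g, b ^+ x * c ^+ y] = 1.
    apply/eqP/commgP/ker_commute => //.
    by have := r_span 0 x y; rewrite !mul1g.
  rewrite defh dE -mulgA adM cx mulg1 adX -bk expgMn; last exact/commute_sym/cC.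
  rewrite -!expgM (mulnC _ k) (mulnC _ k) (expgM c) -adXl bk.
  by rewrite (_ : [~ g, a, a] = 1) ?expg1n ?mulg1 //; apply/eqP/commgP/class2.
by rewrite commgC -mulgA -commC mulgA.
Qed.

Lemma central_extension_onto : exists (H : groupType) (f : UMagmaMorphism.type H X),
    (forall g, exists h, f h = g) /\ (forall h, f h = 1 <-> central h).
Proof.
have [F defF] := @morph_group H X f fM.
by exists H, F; rewrite defF; split; [exact: f_surj | exact: ker_f].
Qed.

End Extension.

(** * Necessity: powers in groups of class three *)

(* commXg and expMg_Rmul for possibly infinite groups.                          *)
Lemma commXg_group (H : groupType) (x y : H) i :
  commute x [~ x, y] -> [~ x ^+ i, y] = [~ x, y] ^+ i.
Proof.
move=> cx; elim: i => [|i IHi]; first exact: comm1g.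
have JM (u v w : H) : [~ u * v, w] = [~ u, w] ^ v * [~ v, w].
  by rewrite !commgEr conjgM mulgA -conjMg mulgK.
rewrite !expgS JM IHi; congr (_ * _).
exact/conjg_fixP/commgP/commuteX/commute_sym.
Qed.

Lemma expMg_group (H : groupType) (x y : H) i :
    commute x [~ y, x] -> commute y [~ y, x] ->
  (x * y) ^+ i = x ^+ i * y ^+ i * [~ y, x] ^+ 'C(i, 2).
Proof.
move=> cx cy; elim: i => [|i IHi]; first by rewrite !mulg1.
rewrite !expgSr IHi binS bin1 addnC expgnDr.
have cw : commute ([~ y, x] ^+ 'C(i, 2)) (x * y).
  by apply/commute_sym/commuteX/commute_sym/commuteM; apply/commute_sym.
rewrite -(mulgA (_ * _)) cw !mulgA; congr (_ * _).
rewrite -(mulgA _ (y ^+ i) x) (commgC (y ^+ i) x) commXg_group // !mulgA.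
by rewrite -(mulgA _ ([~ y, x] ^+ i) y) (commute_sym (commuteX i cy)) !mulgA.
Qed.

(** Since y^n is central, y^n = (y^x)^n = y^n [y, x]^n [y, x, y]^C(n, 2). The last factor is trivial
    because [y, x, y]^n = [[y, x]^n, y] = 1, so [y, x]^n = 1. Expanding (x^y)^n the same way gives
    (x^n)^y = x^n. *)
Lemma commute_expg_class3 (H : groupType) (x y : H) n :
    odd n -> (forall u v w : H, central [~ u, v, w]) ->
    central (y ^+ n) -> central ([~ y, x] ^+ n) ->
  commute (x ^+ n) y.
Proof.
move=> odd_n class3 yn cn.
have expC (u v w : H) : [~ u, v] ^+ n = 1 -> [~ u, v, w] ^+ 'C(n, 2) = 1.
  move=> uvn; rewrite bin2odd // expgnA -commXg_group ?uvn ?comm1g ?expg1n //.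
  exact/commute_sym/class3.
have expM (u v : H) : (u ^ v) ^+ n = u ^+ n * [~ u, v] ^+ n * [~ u, v, u] ^+ 'C(n, 2).
  rewrite (_ : u ^ v = u * [~ u, v]); last by rewrite commgEl mulKVg.
  by apply: expMg_group; apply/commute_sym/class3.
have yx1 : [~ y, x] ^+ n = 1.
  have w1 : [~ y, x, y] ^+ 'C(n, 2) = 1.
    rewrite bin2odd // expgnA -commXg_group; last exact/commute_sym/class3.
    by rewrite (_ : [~ _ ^+ n, y] = 1) ?expg1n //; apply/eqP/commgP/cn.
  apply: (mulgI (y ^+ n)); have := expM y x; rewrite w1 !mulg1 => <-.
  by rewrite -conjXg; apply/conjg_fixP/commgP/yn.
have xy1 : [~ x, y] ^+ n = 1 by rewrite -invgR expVgn yx1 invg1.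
apply/commgP/conjg_fixP; rewrite conjXg expM xy1 expC //.
by rewrite !mulg1.
Qed.

(** By finiteness, closure under products suffices; no clause for inverses is needed. *)
Lemma mem_gen2 (gT : finGroupType) (a b : gT) (P : pred gT) :
    P 1 -> (forall x y, P x -> P y -> P (x * y)) -> P a -> P b ->
  forall x, x \in <<[set a; b]>> -> P x.
Proof.
move=> P1 PM Pa Pb x.
have gP : group_set [set x | P x].
  by apply/group_setP; split=> [|u v]; rewrite !inE //; apply: PM.
suff : <<[set a; b]>> \subset Group gP by move/subsetP/[apply]; rewrite inE.
by rewrite gen_subG; apply/subsetP=> u /set2P[]->; rewrite inE.
Qed.

Lemma gen2_mem (gT : finGroupType) (G : {group gT}) (a b : gT) :
  G :=: <<[set a; b]>> -> a \in G /\ b \in G.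
Proof. by move=> ->; split; apply: mem_gen; rewrite !inE eqxx ?orbT. Qed.

Lemma class2_commute (gT : finGroupType) (G : {group gT}) :
  nil_class G <= 2 -> {in G & &, forall x y z, commute [~ x, y] z}.
Proof.
rewrite nil_class2 => /subsetP sG'Z x y z Gx Gy Gz.
have /sG'Z/centerP[_] : [~ x, y] \in G^`(1) by rewrite mem_commg.
exact.
Qed.

Lemma val_subgX (gT : finGroupType) (G : {group gT}) (x : [subg G]) k :
  val (x ^+ k) = val x ^+ k.
Proof. by elim: k => // k IHk; rewrite !expgS -IHk. Qed.

Lemma capable_exp_gen (gT : finGroupType) (G : {group gT}) (a b : gT) n :
    nil_class G <= 2 -> capable G -> odd n -> G :=: <<[set a; b]>> ->
  b ^+ n = 1 -> a ^+ n = 1.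
Proof.
move=> /class2_commute cl2 /capableP[H [f [f_surj ker_f]]] odd_n defG bn.
have [Ga Gb] := gen2_mem defG.
have cl2s (u v w : [subg G]) : [~ u, v, w] = 1.
  by apply/val_inj/eqP/commgP/cl2; apply: subgP.
have class3 (u v w : H) : central [~ u, v, w].
  by apply/ker_f; rewrite (gmulfR f) (gmulfR f).
have [x fx] := f_surj (subg G a); have [y fy] := f_surj (subg G b).
have yn : central (y ^+ n).
  by apply/ker_f; rewrite gmulfXn fy; apply: val_inj; rewrite val_subgX /= subgK.
have cn : central ([~ y, x] ^+ n).
  apply/ker_f; rewrite gmulfXn (gmulfR f); set u := f y; set v := f x.
  rewrite -(commXg n (x := u)); last exact/commute_sym/commgP/eqP/cl2s.
  suff -> : u ^+ n = 1 by rewrite comm1g.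
  by rewrite /u -gmulfXn; apply/ker_f.
have cxy := commute_expg_class3 odd_n class3 yn cn.
suff /ker_f : central (x ^+ n).
  by rewrite gmulfXn fx => /(congr1 val); rewrite val_subgX /= subgK.
(* Each g in G has a lift commuting with x ^+ n; two lifts differ by a central element, so x ^+ n
   commutes with all of H. *)
pose P (g : gT) := `[< exists2 h, val (f h) = g & commute (x ^+ n) h >].
have Pgen g : g \in G -> P g.
  rewrite {1}defG; apply: mem_gen2 => {g} [|u v||].
  - by apply/asboolP; exists 1; [rewrite gmulf1 | apply: commute1].
  - move=> /asboolP[h <- ch] /asboolP[k <- ck]; apply/asboolP.
    by exists (h * k); [rewrite gmulfM | apply: commuteM].
  - apply/asboolP; exists x; first by rewrite fx /= subgK.
    exact/commute_sym/commuteX.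
  - by apply/asboolP; exists y; first by rewrite fy /= subgK.
move=> h; have /Pgen/asboolP[k /val_inj fk ck] := subgP (f h).
rewrite -[h](mulVKg k); apply: commuteM => //; apply/commute_sym.
suff /ker_f cz : f (k^-1 * h) = 1 by exact: cz.
by rewrite gmulfM gmulfV fk mulVg.
Qed.

(** * Power maps in class two and type invariants *)

Lemma ltn_count (T : eqType) (P Q : pred T) (s : seq T) x :
  subpred P Q -> x \in s -> ~~ P x -> Q x -> count P s < count Q s.
Proof.
move=> sPQ; elim: s => //= y s IHs; rewrite inE => /predU1P[<- | sx] nPx Qx.
  by rewrite (negPf nPx) Qx add0n add1n ltnS sub_count.
by rewrite -addnS leq_add ?IHs //; case: (P y) (sPQ y) => // ->.
Qed.

Lemma card_Ldiv_prime_cyclic (gT : finGroupType) p (Z : {group gT}) :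
  prime p -> p.-group Z -> cyclic Z -> #|'Ldiv_p(Z)| <= p.
Proof.
move=> p_pr pZ cycZ; have [-> | ntZ] := eqVneq (Z : {set gT}) 1.
  by rewrite (leq_trans (subset_leq_card (subsetIl _ _))) ?cards1 ?prime_gt0.
rewrite -[leqRHS](Ohm1_cyclic_pgroup_prime cycZ pZ ntZ) (OhmE 1 pZ) expn1.
exact/subset_leq_card/subset_gen.
Qed.

Section Class2.

Variables (gT : finGroupType) (G : {group gT}).
Hypothesis cl2 : {in G & &, forall x y z, commute [~ x, y] z}.

Lemma comm_exp_class2 x y n :
  x \in G -> y \in G -> x ^+ n = 1 -> [~ x, y] ^+ n = 1.
Proof.
move=> Gx Gy xn; rewrite -commXg ?xn ?comm1g //; exact/commute_sym/cl2.
Qed.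

Lemma expMg_class2 x y n : x \in G -> y \in G ->
  (x * y) ^+ n = x ^+ n * y ^+ n * [~ y, x] ^+ 'C(n, 2).
Proof. by move=> Gx Gy; apply: expMg_Rmul; apply/commute_sym/cl2. Qed.

(** Regularity: if x^n = y^n, then [y^-1, x]^n = [y^-n, x] = 1, so the correction term in (x y^-1)^n
    vanishes. The converse expands (x y^-1) y. *)
Lemma eq_expg_class2 x y n : odd n -> x \in G -> y \in G ->
  (x ^+ n == y ^+ n) = ((x * y^-1) ^+ n == 1).
Proof.
move=> odd_n Gx Gy; have GVy := groupVr Gy.
have binX (z : gT) : z ^+ n = 1 -> z ^+ 'C(n, 2) = 1.
  by move=> zn; rewrite bin2odd // expgM zn expg1n.
apply/eqP/eqP=> [eqxy | uv1].
  rewrite expMg_class2 // expgVn eqxy mulgV mul1g binX //.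
  rewrite -commXg; last exact/commute_sym/cl2.
  by rewrite expgVn -eqxy; apply/eqP/commgP/commute_sym/commuteV/commuteX.
rewrite -[x in LHS](mulgVK y) expMg_class2 ?groupM // uv1 mul1g binX ?mulg1 //.
by rewrite -invg_comm expgVn comm_exp_class2 ?invg1 ?groupM.
Qed.

Lemma Ldiv_group_set n : odd n -> group_set 'Ldiv_n(G).
Proof.
move=> odd_n; apply/group_setP; split=> [|x y]; first by rewrite !inE group1 expg1n /=.
move=> /LdivP[Gx xn] /LdivP[Gy yn]; apply/LdivP; split; first exact: groupM.
apply/eqP; rewrite -[y]invgK -eq_expg_class2 ?groupV //.
by rewrite xn expgVn yn invg1.
Qed.

(** The fibers of the n-th power map are the right cosets of {x | x^n = 1}, so the cosets meeting D
    correspond to the n-th powers of its elements. *)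
Lemma index_Ldiv n (D : {set gT}) : odd n -> D \subset G ->
  #|D : 'Ldiv_n(G)| = #|[set x ^+ n | x in D]|.
Proof.
move=> odd_n sDG; pose K := Group (Ldiv_group_set odd_n).
have fibers : {in D &, forall x y, (K :* x == K :* y) = (x ^+ n == y ^+ n)}.
  move=> x y /(subsetP sDG) Gx /(subsetP sDG) Gy.
  rewrite (sameP eqP rcoset_eqP) mem_rcoset !inE.
  by rewrite groupM ?groupV ?eq_expg_class2.
have reprX : {in D, forall x, fingroup.repr (rcoset K x) ^+ n = x ^+ n}.
  move=> x /(subsetP sDG) Gx; apply/eqP; have := mem_repr_rcoset K x.
  rewrite rcosetE mem_rcoset => /LdivP[Grx rxn].
  rewrite eq_expg_class2 // ?rxn //.
  by rewrite -[fingroup.repr _](mulgKV x) groupM.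
rewrite -(eq_in_imset reprX) (imset_comp (fun A => fingroup.repr A ^+ n)).
rewrite card_in_imset; first exact: erefl.
move=> _ _ /imsetP[x Dx ->] /imsetP[y Dy ->].
by rewrite !reprX // => eqxy; rewrite !rcosetE; apply/eqP; rewrite fibers // eqxy.
Qed.

Section TypeInvariants.

Variable p : nat.
Hypotheses (p_pr : prime p) (p_odd : odd p) (pG : p.-group G).

(** The logarithm in [omega] loses nothing: the index of one subgroup of a p-group in another is a
    power of p. *)
Lemma expn_omega i :
  (p ^ omega p G i.+1)%N = #|[set x ^+ (p ^ i) | x in 'Ldiv_(p ^ i.+1)(G)]|.
Proof.
have odd_pX j : odd (p ^ j)%N by rewrite oddX p_odd orbT.
rewrite -index_Ldiv ?subsetIl // -p_part part_pnat_id //=.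
pose Om j := Group (Ldiv_group_set (odd_pX j)).
have pOm : p.-group (Om i.+1) by rewrite (pgroupS _ pG) //= subsetIl.
exact: pnat_dvd (dvdn_indexg (Om i.+1) (Om i)) pOm.
Qed.

Lemma omega_decr i j : i <= j -> omega p G j.+1 <= omega p G i.+1.
Proof.
have step k : omega p G k.+2 <= omega p G k.+1; last first.
  by move=> /subnK <-; elim: (j - i) => //= k; apply: leq_trans (step _).
rewrite -(leq_exp2l _ _ (prime_gt1 p_pr)) !expn_omega; apply/subset_leq_card.
apply/subsetP=> _ /imsetP[x /LdivP[Gx xn] ->]; rewrite expnS expgM.
by apply: imset_f; apply/LdivP; rewrite groupX // -expgM -expnS.
Qed.

Lemma expn_omega_exponent e : exponent G %| (p ^ e.+1)%N ->
  (p ^ omega p G e.+1)%N = #|[set x ^+ (p ^ e) | x in G]|.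
Proof.
move=> expG; rewrite expn_omega (setIidPl _) //; apply/subsetP=> x Gx.
by rewrite inE -order_dvdn (dvdn_trans (dvdn_exponent Gx)).
Qed.

Lemma omega_gt0 e i : exponent G = (p ^ e)%N -> (0 < omega p G i.+1) = (i < e).
Proof.
move=> expG; have p_gt1 := prime_gt1 p_pr.
have [e_le_i | i_lt_e] := leqP e i.
  have xi x : x \in G -> x ^+ (p ^ i) = 1.
    move=> Gx; apply/eqP; rewrite -order_dvdn (dvdn_trans (dvdn_exponent Gx)) //.
    by rewrite expG dvdn_exp2l.
  apply/negbTE; rewrite -leqNgt -(leq_exp2l _ _ p_gt1) expn_omega expn0 -(cards1 (1 : gT)).
  apply/subset_leq_card/subsetP=> _ /imsetP[x /LdivP[Gx _] ->].
  by rewrite xi // inE.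
case: e => // e in expG i_lt_e *; apply: leq_trans (omega_decr (ltnSE i_lt_e)).
have [x Gx ox] := exponent_witness (pgroup_nil pG).
rewrite -(ltn_exp2l _ _ p_gt1) expn_omega_exponent ?expG //.
apply/card_gt1P; exists 1, (x ^+ (p ^ e)); split.
- by apply/imsetP; exists 1; rewrite ?expg1n.
- exact: imset_f.
by rewrite eq_sym -order_dvdn -ox expG dvdn_Pexp2l ?ltnn.
Qed.

(** The first invariant counts the indices with [omega] positive, which are 1, ..., e + 1; the
    second counts those with [omega] at least 2. As [omega] is nonincreasing, the counts agree
    exactly when its value at e + 1 is at least 2. *)
Lemma type_invariants01 e : exponent G = (p ^ e.+1)%N ->
  (nth 0 (type_invariants p G) 0 == nth 0 (type_invariants p G) 1) =
    (1 < omega p G e.+1).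
Proof.
move=> expG; have om1 : 0 < omega p G 1 by rewrite (omega_gt0 _ expG).
have nth_ti k : nth 0 (type_invariants p G) k =
    if k < omega p G 1 then type_invariant p G k.+1 else 0.
  case: ltnP => [k_lt | k_ge]; last by rewrite nth_default ?size_map ?size_iota.
  by rewrite (nth_map 0) ?size_iota // nth_iota.
have [om_gt1 | om_le1] := ltnP 1 (omega p G e.+1).
  have om1_gt1 := leq_trans om_gt1 (omega_decr (leq0n e)).
  rewrite !nth_ti om1 om1_gt1; apply/eqP/eq_in_count => -[|i]; rewrite mem_iota //= => _.
  rewrite (omega_gt0 _ expG); apply/idP/idP => [i_le | /ltnW].
    exact: leq_trans om_gt1 (omega_decr (ltnSE i_le)).
  by rewrite (omega_gt0 _ expG).
apply/negbTE; rewrite neq_ltn orbC !nth_ti om1; apply/orP; left.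
(* If [omega p G 1] is 1, there is no second invariant and [nth] returns 0, which still obeys this
   bound. *)
apply: (@leq_ltn_trans (type_invariant p G 2)); first by case: ifP.
apply: (@ltn_count _ _ _ _ e.+1) => [i /ltnW //|||] /=.
- rewrite mem_iota /= add1n ltnS -(@leq_exp2l p) ?prime_gt1 //.
  by rewrite -(card_pgroup pG) -expG dvdn_leq ?exponent_dvdn.
- by rewrite -leqNgt.
- by rewrite (omega_gt0 _ expG).
Qed.

End TypeInvariants.

End Class2.

(** * Choosing two generators *)

Lemma grank_le2_gen (gT : finGroupType) (G : {group gT}) :
  'm(G) <= 2 -> exists u v, G :=: <<[set u; v]>>.
Proof.
have [B <- <-] := grank_witness G; rewrite leq_eqVlt ltnS.
case/orP=> [/cards2P[u [v [_ ->]]] | /card_le1_eqP B1]; first by exists u, v.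
have [-> | [u Bu]] := set_0Vmem B.
  exists 1, 1; apply/eqP; rewrite eqEsubset genS ?sub0set //= gen0 gen_subG.
  by apply/subsetP=> x /set2P[]->; rewrite inE.
exists u, u; congr <<_>>; apply/setP=> x; rewrite !inE orbb.
by apply/idP/eqP=> [Bx | ->//]; apply: B1.
Qed.

Lemma gen2_mulr (gT : finGroupType) (u v w : gT) :
  w \in <[u]> -> <<[set u; v * w]>> = <<[set u; v]>>.
Proof.
have sub (x y : gT) : y \in <[u]> -> <<[set u; x * y]>> \subset <<[set u; x]>>.
  move=> uy; rewrite gen_subG; apply/subsetP=> z.
  have Xu : u \in <<[set u; x]>> by rewrite mem_gen ?set21.
  case/set2P=> -> //; rewrite groupM ?(mem_gen (set22 _ _)) //.
  by apply: subsetP uy; rewrite cycle_subG.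
move=> uw; apply/eqP; rewrite eqEsubset sub //.
by rewrite -{1}[v](mulgK w) sub ?groupV.
Qed.

Lemma span_class2 (gT : finGroupType) (G : {group gT}) (a b : gT) :
    {in G & &, forall x y z, commute [~ x, y] z} -> G :=: <<[set a; b]>> ->
  forall g, g \in G -> exists i k l, g = a ^+ i * b ^+ k * [~ b, a] ^+ l.
Proof.
move=> cl2 defG g Gg.
have [Ga Gb] := gen2_mem defG.
pose Q h := h \in G /\ exists i k l, h = a ^+ i * b ^+ k * [~ b, a] ^+ l.
suff /asboolP[] : `[< Q g >] by [].
move: Gg; rewrite {1}defG; apply: (mem_gen2 (P := fun h => `[< Q h >])).
- by apply/asboolP; split; [exact: group1 | exists 0, 0, 0; rewrite !mulg1].
- move=> x y /asboolP[Gx [i [k [l defx]]]] /asboolP[Gy [i' [k' [l' defy]]]].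
  apply/asboolP; split; first exact: groupM.
  (* The term k * i' comes from moving a ^+ i' left past b ^+ k. *)
  exists (i + i'), (k + k'), (l + l' + k * i').
  have cC h j : h \in G -> commute ([~ b, a] ^+ j) h.
    by move=> Gh; apply/commute_sym/commuteX/commute_sym/cl2.
  rewrite defx defy -!mulgA (cC _ l) ?groupM ?groupX ?groupR //.
  rewrite !expgD -!mulgA; congr (_ * _).
  rewrite (mulgA (b ^+ k)) (commgC (b ^+ k) (a ^+ i')).
  rewrite commXXg; try exact/commute_sym/cl2.
  rewrite -!mulgA; congr (_ * (_ * _)).
  rewrite (mulgA _ (b ^+ k')) (cC (b ^+ k')) ?groupX //.
  by rewrite -mulgA; congr (_ * _); rewrite -!expgD addnC -addnA addnCA.
- by apply/asboolP; split=> //; exists 1%N, 0, 0; rewrite !mulg1.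
- by apply/asboolP; split=> //; exists 0, 1%N, 0; rewrite mulg1 mul1g.
Qed.

(** The p elements of the cycle of u ^+ n are n-th powers of powers of u, so they exhaust a set of
    at most p elements. *)
Lemma card_le_powers_cycle (gT : finGroupType) (G : {group gT}) (u : gT) p n :
    prime p -> u \in G -> u ^+ n != 1 -> u ^+ (n * p) = 1 ->
    #|[set x ^+ n | x in G]| <= p ->
  [set x ^+ n | x in G] = <[u ^+ n]>.
Proof.
move=> p_pr Gu un unp leP; have oun : #[u ^+ n] = p.
  by apply: nt_prime_order; rewrite -?expgM.
apply/esym/eqP; rewrite eqEcard -orderE oun leP andbT.
apply/subsetP=> _ /cycleP[i ->]; rewrite -expgM mulnC expgM.
by apply: imset_f; apply: groupX.
Qed.

(** Some generator u has u^n != 1, or else the exponent would divide n. Then v^n = (u^n)^i, and v is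
    replaced by v u^-i. *)
Lemma gen2_expg_eq1 (gT : finGroupType) (G : {group gT}) p n :
    {in G & &, forall x y z, commute [~ x, y] z} -> prime p -> odd n ->
    'm(G) <= 2 -> exponent G = (n * p)%N -> #|[set x ^+ n | x in G]| <= p ->
  exists a b, [/\ G :=: <<[set a; b]>>, b ^+ n = 1 & a ^+ n != 1].
Proof.
move=> cl2 p_pr odd_n /grank_le2_gen[u [v defG]] expG leP.
wlog un : u v defG / u ^+ n != 1 => [IH|].
  have [un | ] := eqVneq (u ^+ n) 1; last exact: (IH u v).
  have [vn | ] := eqVneq (v ^+ n) 1; last by apply: (IH v u); rewrite setUC.
  pose K := Group (Ldiv_group_set cl2 odd_n).
  have [Gu Gv] := gen2_mem defG.
  have sGK : G \subset K.
    by rewrite {1}defG gen_subG; apply/subsetP=> x /set2P[]->; apply/LdivP.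
  have : exponent G %| n.
    by apply/exponentP=> x /(subsetP sGK)/LdivP[].
  rewrite expG -{2}[n]muln1 dvdn_pmul2l; last exact: odd_gt0.
  by rewrite dvdn1 => /eqP p1; rewrite p1 in p_pr.
have [Gu Gv] := gen2_mem defG.
have unp : u ^+ (n * p) = 1 by apply/eqP; rewrite -order_dvdn -expG dvdn_exponent.
have : v ^+ n \in [set x ^+ n | x in G] by apply: imset_f.
rewrite (card_le_powers_cycle p_pr Gu un unp leP) => /cycleP[i vn].
exists u, (v * (u ^+ i)^-1); split=> //.
  by rewrite gen2_mulr ?groupV ?mem_cycle.
apply/eqP; rewrite -(eq_expg_class2 cl2) ?groupX //.
by rewrite vn -!expgM mulnC.
Qed.

(** * Sufficiency: splitting G over a cyclic subgroup *)

Lemma order_pfactor (gT : finGroupType) (x : gT) p e : prime p ->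
  x ^+ (p ^ e.+1) = 1 -> x ^+ (p ^ e) != 1 -> #[x] = (p ^ e.+1)%N.
Proof.
move=> p_pr /eqP; rewrite -!order_dvdn => /(dvdn_pfactor _ _ p_pr)[k le_k ->].
rewrite dvdn_Pexp2l ?prime_gt1 // -ltnNge => lt_k.
by congr (p ^ _)%N; apply/eqP; rewrite eqn_leq le_k.
Qed.

(** Supplies the data of [central_extension_onto]: r projects along K, and t is r followed by a |->
    a * b, well defined because the order of a * b divides the exponent n = #[a]. *)
Lemma capable_of_sdprod (gT : finGroupType) (G K : {group gT}) (a b : gT) n :
    {in G & &, forall x y z, commute [~ x, y] z} -> odd n ->
    exponent G = n -> #[a] = n -> #[b] = n -> G :=: <<[set a; b]>> ->
    K ><| <[a]> = G -> b \in K ->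
  capable G.
Proof.
move=> cl2 odd_n expG oa ob defG defKG Kb.
have [Ga Gb] := gen2_mem defG.
have [nsKG sAG defKA _ tiKA] := sdprod_context defKG.
have compl : <[a]>%G \in [complements to K in G] by apply/complP.
have ab_dvd : #[a * b] %| #[a] by rewrite oa -expG dvdn_exponent ?groupM.
pose rho x := remgr K <[a]> x.
have rhoP x : x \in G -> rho x \in <[a]>.
  by move=> Gx; rewrite /rho mem_remgr // defKA.
have {}sAG := subsetP sAG.
pose r (x : [subg G]) := subg G (rho (val x)).
pose t (x : [subg G]) := subg G (eltm ab_dvd (rho (val x))).
have tauG x : x \in <[a]> -> eltm ab_dvd x \in G.
  by case/cycleP=> i ->; rewrite eltmE groupX ?groupM.
have rM : {morph r : x y / x * y}.
  move=> x y; rewrite /r /rho (remgrM compl nsKG) ?subgP // subgM //; exact/sAG/rhoP/subgP.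
have tM : {morph t : x y / x * y}.
  move=> x y; rewrite /t /rho (remgrM compl nsKG) ?subgP // eltmM ?rhoP ?subgP // subgM //.
    exact/tauG/rhoP/subgP.
  exact/tauG/rhoP/subgP.
have [R defR] := morph_group rM; have [T defT] := morph_group tM.
have rho_a : rho a = a by rewrite /rho remgr_id ?cycle_id //.
have rho_b : rho b = 1 by rewrite /rho remgr1.
case: n => // m in odd_n expG oa ob.
apply/capableP.
apply: (@central_extension_onto _ m (subg G a) (subg G b) R T odd_n).
- move=> x; apply: val_inj; rewrite val_subgX.
  by apply: (exponentP _ _ (subgP x)); rewrite expG.
- by move=> x y z; apply: val_inj; apply: cl2; apply: subgP.
- move=> g; have [i [k [l defg]]] := span_class2 cl2 defG (subgP g).
  exists i, k, l; apply: val_inj.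
  by rewrite [RHS]/= !val_subgX /= !subgK.
- move=> i bi; rewrite -ob order_dvdn; have := congr1 val bi.
  by rewrite val_subgX /= subgK // => ->.
- by rewrite defR /r /= subgK // rho_a.
- by rewrite defR /r /= subgK // rho_b; apply: val_inj; rewrite /= subgK.
- by rewrite defT /t /= subgK // rho_a (eltm_id ab_dvd) subgM.
- rewrite defT /t /= subgK // rho_b.
  have -> : eltm ab_dvd 1 = 1 by exact: (eltmE ab_dvd 0).
  by apply: val_inj; rewrite /= subgK.
Qed.

Lemma capable_of_powers (gT : finGroupType) (G : {group gT}) p e :
    prime p -> odd p -> p.-group G -> nil_class G <= 2 -> 'm(G) <= 2 ->
    exponent G = (p ^ e.+1)%N -> p < #|[set x ^+ (p ^ e) | x in G]| ->
  capable G.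
Proof.
move=> p_pr p_odd pG class2 /grank_le2_gen[u [v defG]] expG.
have cl2 := class2_commute class2.
have odd_n j : odd (p ^ j)%N by rewrite oddX p_odd orbT.
rewrite ltnNge => /negP gtP.
have xN x : x \in G -> x ^+ (p ^ e.+1) = 1.
  by apply: exponentP; rewrite expG.
have nG' := der_norm 1 G; have nsG' := der_normal 1 G; have sG' := der_sub 1 G.
(* Otherwise all p^e-th powers lie in G', which is cyclic, generated by a commutator of u and v;
   being killed by p, they number at most p. *)
wlog un : u v defG / u ^+ (p ^ e) \notin G^`(1) => [IH|].
  have [un | ] := boolP (u ^+ (p ^ e) \in G^`(1)); last exact: (IH u v).
  have [vn | ] := boolP (v ^+ (p ^ e) \in G^`(1)); last by apply: (IH v u); rewrite setUC.
  case: gtP; have [Gu Gv] := gen2_mem defG.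
  have cycG' : cyclic G^`(1).
    have defG1 : G :=: <[u]> <*> <[v]> by rewrite joing_idl joing_idr.
    rewrite defG1 der1_joing_cycles ?cycle_cyclic // -defG1.
    by apply/centP=> z Gz; apply: cl2.
  have powG' x : x \in G -> (x \in G) && (x ^+ (p ^ e) \in G^`(1)).
    rewrite {1}defG; apply: (mem_gen2 (P := fun y => (y \in G) && (_ \in _))).
    - by rewrite expg1n !group1.
    - move=> y z /andP[Gy yn] /andP[Gz zn]; rewrite groupM //=.
      rewrite (expMg_class2 cl2) //; apply/groupM/groupX/mem_commg => //.
      exact: groupM.
    - by rewrite un Gu.
    - by rewrite vn Gv.
  apply: leq_trans (card_Ldiv_prime_cyclic p_pr (pgroupS sG' pG) cycG').
  apply/subset_leq_card/subsetP=> _ /imsetP[x Gx ->]; apply/LdivP.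
  by case/andP: (powG' x Gx) => _ ->; rewrite -expgM -expnSr xN.
have [Gu Gv] := gen2_mem defG.
have ou : #[u] = (p ^ e.+1)%N.
  by apply: order_pfactor; rewrite ?xN //; apply: contraNneq un => ->.
pose u1 := coset G^`(1) u.
have ou1 : #[u1] = (p ^ e.+1)%N.
  apply: order_pfactor => //; rewrite -morphX ?(subsetP nG') //= ?xN ?morph1 //.
  by apply: contraNneq un => /coset_idr-> //; rewrite groupX // (subsetP nG').
have expQ : #[u1] = exponent (G / G^`(1)).
  apply/eqP; rewrite eqn_dvd dvdn_exponent ?mem_quotient //= ou1 -expG.
  exact: exponent_quotient.
have cQ : abelian (G / G^`(1)) := der_abelian 0 G.
(* The coset of u has order the exponent of the abelian group G / G', so its cycle has a complement
   B. Below, b is v corrected by a power of u so that its coset lies in B. *)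
have /splitsP[B /complP[tiB defQ]] := abelian_splits (mem_quotient _ Gu) expQ cQ.
have : coset G^`(1) v \in <[u1]> * B by rewrite defQ mem_quotient.
case/mulsgP=> _ w /cycleP[i ->] Bw defv.
pose b := v * (u ^+ i)^-1.
have defG2 : G :=: <<[set u; b]>> by rewrite gen2_mulr ?groupV ?mem_cycle.
have Gb : b \in G by rewrite groupM ?groupV ?groupX.
have cosetb : coset G^`(1) b = w.
  rewrite morphM ?morphV ?morphX ?groupV ?groupX ?(subsetP nG') //= defv.
  rewrite (centsP cQ (u1 ^+ i) _ w) ?mulgK ?groupX ?mem_quotient //.
  by rewrite -defQ (subsetP (mulG_subr _ _)).
pose K := (<[b]> <*> G^`(1))%G.
have nsKG : K <| G.
  by rewrite sub_der1_normal ?joing_subr // join_subG cycle_subG Gb der_sub.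
have Kb : b \in K by rewrite mem_gen // inE cycle_id.
apply: (@capable_of_sdprod _ G K u b (p ^ e.+1)) => //.
(* If b^(p^e) = 1, all p^e-th powers lie in the cycle of u^(p^e), which has order p. *)
- apply: order_pfactor; rewrite ?xN //; apply/eqP=> bn; case: gtP.
  have oun : #[u ^+ (p ^ e)] = p.
    by rewrite orderXdiv ou ?dvdn_exp2l // expnS mulnK // expn_gt0 prime_gt0.
  rewrite -[X in _ <= X]oun; apply/subset_leq_card/subsetP=> _ /imsetP[x Gx ->].
  have [j [k [l ->]]] := span_class2 cl2 defG2 Gx.
  set y := b ^+ k; set z := _ ^+ l.
  have [Gy Gz] : y \in G /\ z \in G by rewrite !groupX ?groupR.
  have yzn : (y * z) ^+ (p ^ e) = 1.
    rewrite expgMn; last exact/commuteX/commute_sym/cl2.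
    rewrite -!expgM mulnC expgM bn expg1n mulnC expgM.
    by rewrite (comm_exp_class2 cl2 Gb Gu bn) expg1n mul1g.
  have -> : (u ^+ j * y * z) ^+ (p ^ e) = (u ^+ j) ^+ (p ^ e).
    apply/eqP; rewrite (eq_expg_class2 cl2) ?groupM ?groupX ?groupR //.
    have -> : u ^+ j * y * z * (u ^+ j)^-1 = (y * z) ^ (u ^+ j)^-1.
      by rewrite conjgE invgK !mulgA.
    by rewrite -conjXg yzn conj1g.
  by rewrite -expgM mulnC expgM mem_cycle.
- have nKu : <[u]> \subset 'N(K).
    by rewrite cycle_subG (subsetP (normal_norm nsKG)).
  rewrite sdprodE //.
    apply/eqP; rewrite eqEsubset mul_subG ?cycle_subG ?(normal_sub nsKG) //=.
    suff: <<[set u; b]>> \subset K <*> <[u]> by rewrite -defG2 (norm_joinEr nKu).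
    rewrite gen_subG; apply/subsetP=> x /set2P[]->.
      by rewrite mem_gen // inE cycle_id orbT.
    by rewrite mem_gen // inE Kb.
  (* The coset of x lies both in the cycle of u1 and in B, hence is trivial; as u and u1 have the
     same order, so is x. *)
  apply/trivgP/subsetP=> x /setIP[Kx /cycleP[j defx]].
  have sKB : K / G^`(1) \subset B.
    rewrite quotientYidr ?cycle_subG ?(subsetP nG') // quotient_cycle ?(subsetP nG') //.
    by rewrite cycle_subG cosetb.
  have : coset G^`(1) x \in <[u1]> :&: B.
    rewrite inE (subsetP sKB) ?mem_quotient // andbT defx.
    by rewrite morphX ?(subsetP nG') //= mem_cycle.
  rewrite tiB defx morphX ?(subsetP nG') //= inE -order_dvdn ou1 -ou order_dvdn.
  by rewrite inE.
Qed.

Theorem corollary6p4 (gT : finGroupType) (p : nat) (G : {group gT})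
    (p_prime : prime p) (p_odd : odd p) (pG : (p.-group G)%g)
    (G_noncyclic : ~~ cyclic G) (G_2gen : 'm(G)%g <= 2)
    (G_class2 : nil_class G <= 2)
    (alpha beta : nat)
    (def_alpha : alpha = nth 0 (type_invariants p G) 0)
    (def_beta : beta = nth 0 (type_invariants p G) 1) :
  capable G <-> alpha = beta.
Proof.
have cl2 := class2_commute G_class2.
have odd_pX j : odd (p ^ j)%N by rewrite oddX p_odd orbT.
have [e expG] : exists e, exponent G = (p ^ e.+1)%N.
  have [x Gx ox] := exponent_witness (pgroup_nil pG).
  have [[|e] oe] := p_natP (mem_p_elt pG Gx); last by exists e; rewrite ox.
  have G1 : G :=: 1.
    by apply/eqP; rewrite trivg_exponent ox oe.
  by rewrite G1 cyclic1 in G_noncyclic.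
suff capE : capable G <-> 1 < omega p G e.+1.
  rewrite def_alpha def_beta; apply: (iff_trans capE).
  by rewrite -(type_invariants01 cl2 p_prime p_odd pG expG); split=> /eqP.
rewrite -(ltn_exp2l _ _ (prime_gt1 p_prime)) expn1.
rewrite (expn_omega_exponent cl2 p_odd pG) ?expG //.
split=> [capG|]; last exact: capable_of_powers.
rewrite ltnNge; apply/negP=> leP.
have [|a [b [defG bn /eqP]]] := gen2_expg_eq1 cl2 p_prime (odd_pX e) G_2gen _ leP.
  by rewrite expG expnSr.
by case; apply: capable_exp_gen defG bn.
Qed.
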